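(* Let $X$ be an infinite regular cardinal. Then $\mathrm{Pol}(T_1)=\langle\{\mathrm{med}_3,p_\Delta\}\cup\mathcal O^{(1)}\rangle$. In particular, $\mathrm{Pol}(T_1)$ is finitely generated over the unary functions (that is, it is generated by $\mathcal O^{(1)}$ together with finitely many functions).
   Context: $\mathcal O^{(n)}$ is the set of all functions $X^n\to X$, $\mathcal O=\bigcup_{n\geq 1}\mathcal O^{(n)}$. A clone is a subset of $\mathcal O$ containing all projections and closed under composition; $\langle\mathcal F\rangle$ is the smallest clone containing $\mathcal F$. A function $f\in\mathcal O^{(n)}$ is almost unary if there exist $F\in\mathcal O^{(1)}$ and $1\leq k\leq n$ such that $f(x_1,\ldots,x_n)<F(x_k)$ for all $(x_1,\ldots,x_n)\in X^n$ (here $<$ is the well-order of the cardinal $X$). $T_1$ is the set of all binary almost unary functions. $\mathrm{Pol}(T_1)$ is the set of all $f\in\mathcal O$, say of arity $n$, such that $f(g_1,\ldots,g_n)\in T_1$ for all $g_1,\ldots,g_n\in T_1$. $\mathrm{med}_3\in\mathcal O^{(3)}$ is the median: $\mathrm{med}_3(x_1,x_2,x_3)=x_{j_2}$ if $\{j_1,j_2,j_3\}=\{1,2,3\}$ and $x_{j_1}\leq x_{j_2}\leq x_{j_3}$. Fix any injection $p:X^2\to X$ such that $0\in X$ (the least element of $X$) is not in the range of $p$; then $p_\Delta\in\mathcal O^{(2)}$ is defined by $p_\Delta(x_1,x_2)=p(x_1,x_2)$ if $x_2<x_1$, and $p_\Delta(x_1,x_2)=0$ otherwise. *)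

(* Defs.v *)
From mathcomp Require Import all_boot all_order.
From mathcomp Require Import boolp classical_sets functions cardinality wochoice.

Set Implicit Arguments.
Unset Strict Implicit.
Unset Printing Implicit Defensive.

Import Order.TTheory.

Local Open Scope classical_set_scope.
Local Open Scope card_scope.
Local Open Scope order_scope.

(* A cardinal is an initial ordinal: a well-order none of whose proper initial
segments is equipotent to the whole. *)

Section Cardinals.
Context {d : Order.disp_t} (X : orderType d).

Definition is_cardinal : Prop :=
  well_order (<=%O : rel X) /\
  forall x : X, ~ ([set: X] #<= [set y : X | y < x]).

Definition cofinal (A : set X) : Prop := forall x, exists2 a, A a & x <= a.

(* The cofinality is the cardinal itself. *)
Definition is_regular : Prop := forall A, cofinal A -> [set: X] #<= A.

Definition infinite_regular_cardinal : Prop :=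
  [/\ is_cardinal, infinite_set [set: X] & is_regular].

End Cardinals.

(* Indices run over 0, ..., n-1 instead of 1, ..., n. *)

Definition op (X : Type) (n : nat) := ('I_n -> X) -> X.

(* Operations of arity at least 1: the tag [n] stands for arity [n.+1]. *)
Definition operation (X : Type) := {n : nat & op X n.+1}.

Definition Op (X : Type) (n : nat) (f : op X n.+1) : operation X :=
  existT (fun n => op X n.+1) n f.

Section Clones.
Context {X : Type}.
Implicit Types (C F : set (operation X)).

Definition unary_ops : set (operation X) := [set Op f | f in [set: op X 1]].

Definition proj n (i : 'I_n) : op X n := fun x => x i.

Definition superpose n m (f : op X n) (g : 'I_n -> op X m) : op X m :=
  fun x => f (fun i => g i x).

Definition is_clone C : Prop :=
  (forall n (i : 'I_n.+1), C (Op (proj i))) /\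
  (forall n m (f : op X n.+1) (g : 'I_n.+1 -> op X m.+1),
     C (Op f) -> (forall i, C (Op (g i))) -> C (Op (superpose f g))).

Definition clone_gen F : set (operation X) := smallest is_clone F.

Definition Pol (T : set (op X 2)) : set (operation X) :=
  [set F | let: existT n f := F in
           forall g : 'I_n.+1 -> op X 2,
             (forall i, T (g i)) -> T (superpose f g)].

End Clones.

Section AlmostUnary.
Context {d : Order.disp_t} {X : orderType d}.

Definition almost_unary n (f : op X n) : Prop :=
  exists (F : X -> X) (k : 'I_n), forall x, f x < F (x k).

Definition T1 : set (op X 2) := [set f | almost_unary f].

End AlmostUnary.

Section Generators.
Context {d : Order.disp_t} {X : bOrderType d}.

Definition med3 : op X 3 :=
  fun x => nth \bot (sort <=%O [seq x i | i <- enum 'I_3]) 1.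

Lemma med3E (x : 'I_3 -> X) (j1 j2 j3 : 'I_3) :
  uniq [:: j1; j2; j3] -> x j1 <= x j2 <= x j3 -> med3 x = x j2.
Proof.
move=> uj /andP[le12 le23].
have perm_j : perm_eq [:: j1; j2; j3] (enum 'I_3).
  apply: uniq_perm => //; first exact: enum_uniq.
  have sub_j : {subset [:: j1; j2; j3] <= enum 'I_3}.
    by move=> i _; rewrite mem_enum.
  by have [|_] := uniq_min_size uj sub_j; rewrite ?size_enum_ord.
rewrite /med3 (_ : sort _ _ = [:: x j1; x j2; x j3]) //.
apply: le_sorted_eq; first exact: sort_le_sorted.
  by rewrite /= le12 le23.
by rewrite perm_sort perm_sym (perm_map x perm_j).
Qed.

Definition p_Delta (p : X * X -> X) : op X 2 :=
  fun x => let x1 := x ord0 in let x2 := x ord_max in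
           if x2 < x1 then p (x1, x2) else \bot.

End Generators.

(* Main.v *)
Require Import Defs.
From mathcomp Require Import all_boot all_order.
From mathcomp Require Import boolp classical_sets functions cardinality.

(** Write C for the clone generated by the median, p_Delta and the unary
operations.

That C lies in Pol(T1) is a check on generators.  Regularity makes the image of
a proper initial segment bounded, which handles the unary operations and
p_Delta: the value of p_Delta is confined by a bound on its first argument
alone.  For the median of three almost unary binary functions, two of them are
controlled by the same variable, and the median is at most their maximum.

Conversely let f in Pol(T1) have arity n.  Say that f is bounded by a set S of
coordinates when bounding the arguments in S bounds f.  Substituting functions
of the first variable on S and functions of the second variable off S shows that
f is bounded by S or by the complement of S ([Pol_T1_bounded_by]).  Hence any
two sets whose complements fail to bound f meet.  For a finite family of
pairwise intersecting sets of coordinates there is a median term t such that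
every V in the family has an i with x_i <= t(x) ([clone_above_intersecting]).
For the family above this means that the coordinates with x_i <= t(x) bound f,
whence f <= F(t) for some unary F ([Pol_T1_dominated]).

It remains to see that domination by a member of C puts f in C, and this is a
matter of coding.  Up to a unary operation, p_Delta stores y next to c as long
as y is not larger than c.  So it codes any finite list of values in C that lie
below some z in C, and every function of such a list can be decoded from the
code by a unary operation ([clone_factor]).  Starting from z = x_j one codes the
whole of x whenever x_j is the largest coordinate, so the operation f_j that
agrees with f there and is zero elsewhere is in C.  All the f_j are at most
F(t), so they can be coded together starting from z = F(t), and f is
recovered from them as their maximum.

A finite generating set is obtained from a pairing of the pairs (u, v) with
v < u, which are the pairs that p_Delta codes.  Such a pairing comes from the
regularity of X, by placing the pairs with first component u in a block above
all the earlier blocks ([exists_triangle_pairing]). *)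

Local Open Scope classical_set_scope.

Section RegularCardinals.
Import Order.TTheory.
Local Open Scope order_scope.
Local Open Scope card_scope.
Context (d : Order.disp_t) (X : bOrderType d).
Hypothesis regX : infinite_regular_cardinal X.

(** * Regular cardinals *)

Lemma lt_well_founded : well_founded (fun x y : X => x < y).
Proof.
have [[woX _] _ _] := regX.
move=> x0; apply: contrapT => nacc.
pose A := [pred x : X | `[< ~ Acc (fun x y : X => x < y) x >]].
have [|z [[/asboolP Az minz] _]] := woX A.
  by exists x0; apply/asboolP.
apply: Az; constructor=> y lt_yz; apply: contrapT => nAy.
by have := minz y (asboolT nAy); rewrite leNgt lt_yz.
Qed.

Lemma injection_unbounded {phi : X -> X} : injective phi ->
  forall b : X, exists v, b <= phi v.
Proof.
have [[_ small] _ _] := regX => phi_inj b; apply: contrapT => bounded.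
apply: (small b); apply: (@card_le_trans _ _ _ (phi @` [set: X])).
  have phi_injT : {in [set: X] &, injective phi} by apply: in2W.
  by have /card_eqPle[] := inj_card_eq phi_injT.
apply: subset_card_le => _ [v _ <-] /=; rewrite ltNge.
by apply/negP => le_b; apply: bounded; exists v.
Qed.

Lemma noncofinal_bounded {A : set X} : ~ cofinal A ->
  exists b, forall x, A x -> x < b.
Proof.
move=> ncof; apply: contrapT => unbounded; apply: ncof => b.
apply: contrapT => nle; apply: unbounded; exists b => x Ax; rewrite ltNge.
by apply/negP => le_bx; apply: nle; exists x.
Qed.

Lemma exists_gt (a : X) : exists b, a < b.
Proof.
have [_ infX reg] := regX.
have [|b lt_b] := @noncofinal_bounded [set a].
  move=> /reg le_Xa; apply: infX.
  exact: card_le_finite le_Xa (finite_set1 a).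
by exists b; apply: lt_b.
Qed.

(** A final segment is cofinal, so regularity gives it the size of X. *)
Lemma injection_above (b : X) :
  exists2 phi : X -> X, injective phi & forall v, b < phi v.
Proof.
have [_ _ reg] := regX.
have /reg/card_leP[f]: cofinal [set x | b < x].
  move=> x; have [y lt_y] := exists_gt (Order.max b x).
  by exists y; move: lt_y; rewrite gt_max => /andP[? /ltW].
pose inT (v : X) : [set: X] := SigSub (mem_set (I : [set: X] v)).
exists (fun v => val (f (inT v))) => [x y /val_inj eq_f|v].
  by have /(congr1 val) := 'inj_f (in_setT _) (in_setT _) eq_f.
exact: set_mem (valP (f (inT v))).
Qed.

(** A proper initial segment is smaller than X, hence so is its image, which by
regularity cannot be cofinal. *)
Lemma image_below_bounded (a : X) (phi : X -> X) :
  exists b, forall y, y < a -> phi y < b.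
Proof.
have [[_ small] _ reg] := regX.
have [|b lt_b] := @noncofinal_bounded (phi @` [set y | y < a]).
  move=> /reg le_X; apply: (small a).
  exact: card_le_trans le_X (card_image_le _ _).
by exists b => y lt_ya; apply: lt_b; exists y.
Qed.

(** By well-founded recursion: the image of the initial segment below u under
[fun u' => H u' (beta u')] is bounded. *)
Lemma exists_fast_growing (H : X -> X -> X) :
  exists beta : X -> X, forall u' u, u' < u -> H u' (beta u') < beta u.
Proof.
have [bnd bndP] := choice (fun w : X * (X -> X) => image_below_bounded w.1 w.2).
pose tot (u : X) (rec : forall u', u' < u -> X) (u' : X) :=
  if pselect (u' < u) is left lt_u then rec u' lt_u else \bot.
pose step (u : X) (rec : forall u', u' < u -> X) :=
  bnd (u, fun u' => H u' (tot u rec u')).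
pose beta := Fix lt_well_founded (fun=> X) step.
exists beta => u' u lt_u.
have betaE : beta u = step u (fun y _ => beta y).
  apply: (Fix_eq lt_well_founded (fun=> X) step) => x f g eq_fg.
  congr (bnd (x, _)); apply/funext => y; congr (H y _).
  by rewrite /tot; case: pselect.
have totE : tot u (fun y _ => beta y) u' = beta u'.
  by rewrite /tot; case: (pselect (u' < u)).
rewrite betaE -{1}totE.
exact: (bndP (u, fun y => H y (tot u (fun z _ => beta z) y)) u' lt_u).
Qed.

Definition triangle_pairing (p : X * X -> X) :=
  (forall u v u' v', v < u -> v' < u' -> p (u, v) = p (u', v') ->
     u = u' /\ v = v')
  /\ (forall u v, v < u -> p (u, v) <> \bot).

(** With phi_b an injection of X above b, put p(u, v) := phi_(beta u)(v), where
beta grows so fast that the values with first component u all lie below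
beta u' as soon as u < u'. *)
Lemma exists_triangle_pairing : exists p, triangle_pairing p.
Proof.
have phiP b : exists phi : X -> X, injective phi /\ forall v, b < phi v.
  by have [phi ? ?] := injection_above b; exists phi.
have [phi {}phiP] := choice phiP.
have [H HP] := choice (fun w : X * X => image_below_bounded w.1 (phi w.2)).
have [beta betaP] := exists_fast_growing (fun u b => H (u, b)).
have block u v u' v' : v < u -> u < u' -> phi (beta u) v < phi (beta u') v'.
  move=> lt_vu lt_uu'; apply: lt_trans (HP (u, beta u) v lt_vu) _.
  by apply: lt_trans (betaP _ _ lt_uu') _; case: (phiP (beta u')).
exists (fun uv => phi (beta uv.1) uv.2).
split=> /= [u v u' v' lt_vu lt_vu' | u v _].
  case: (ltgtP u u') => [lt_u|gt_u|<-] eq_p.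
  - by have := block _ _ _ v' lt_vu lt_u; rewrite eq_p ltxx.
  - by have := block _ _ _ v lt_vu' gt_u; rewrite eq_p ltxx.
  by have [inj_phi _] := phiP (beta u); rewrite (inj_phi _ _ eq_p).
have [_ /(_ v) lt_phi] := phiP (beta u) => eq0.
by move: lt_phi; rewrite eq0 ltx0.
Qed.

(** * Closure of Pol(T1) *)

(** Of two distinct positions in a sorted triple, one is at or before the middle
and one is at or after it. *)
Lemma med3_sandwich (x : 'I_3 -> X) (a b : 'I_3) : a != b ->
  (Order.min (x a) (x b) <= med3 x <= Order.max (x a) (x b)).
Proof.
pose leT : rel 'I_3 := fun i j => x i <= x j.
have: perm_eq (sort leT (enum 'I_3)) (enum 'I_3) by rewrite perm_sort.
have: sorted leT (sort leT (enum 'I_3)).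
  by apply: sort_sorted => i j; apply: le_total.
case: (sort _ _) => [|j1 [|j2 [|j3 [|? ?]]]] srt perm;
  try by move/perm_size: perm; rewrite size_enum_ord.
have uniqj : uniq [:: j1; j2; j3] by rewrite (perm_uniq perm) enum_uniq.
have mem i : i \in [:: j1; j2; j3] by rewrite (perm_mem perm) mem_enum.
move: srt => /= /andP[le12 /andP[le23 _]].
rewrite /leT in le12 le23.
rewrite (@med3E _ _ x j1 j2 j3) ?le12 // => neq_ab.
have := mem a; have := mem b; rewrite !inE ge_min le_max.
move=> /or3P[]/eqP eb /or3P[]/eqP ea; subst a b; rewrite ?eqxx // in neq_ab *;
  by rewrite ?le12 ?le23 ?lexx ?orbT.
Qed.

Lemma Pol_T1_clone : is_clone (Pol (@T1 d X)).
Proof.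
split=> [n i g Tg|n m f g Cf Cg h Th]; first exact: Tg.
by apply: Cf => i; apply: Cg.
Qed.

Lemma Pol_T1_unary : unary_ops `<=` Pol (@T1 d X).
Proof.
move=> _ [f _ <-] g Tg; have [F [k lt_F]] := Tg ord0.
pose phi y := f (fun=> y).
have [B BP] := choice (fun a => image_below_bounded (F a) phi).
exists B, k => x; have := BP (x k) _ (lt_F x).
by rewrite /phi; congr (f _ < _); apply/funext => i; rewrite (ord1 i).
Qed.

(** Three functions share two variables, so two of them are bounded by functions
of the same variable. *)
Lemma Pol_T1_med3 : Pol (@T1 d X) (Op med3).
Proof.
move=> g Tg.
have [F FP] := choice Tg.
have [k {}FP] := choice FP.
have [a [b neq_ab eq_k]] : exists a, exists2 b, a != b & k a = k b.
  apply: contrapT => inj_k.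
  suff: (#|'I_3| <= #|'I_2|)%N by rewrite !card_ord.
  apply: (@leq_card _ _ k) => a b eq_k.
  by apply: contrapT => /eqP neq; apply: inj_k; exists a, b.
exists (fun v => Order.max (F a v) (F b v)), (k a) => x.
have /andP[_ le_med] := med3_sandwich (fun i => g i x) _ _ neq_ab.
apply: le_lt_trans le_med _.
rewrite gt_max !lt_max FP /= orbC; rewrite {1}eq_k FP //.
Qed.

(** When the first argument u is below F(x_k), the nonzero values are p(u, v)
with v < u < F(x_k): apply [image_below_bounded] for v below u, then for u. *)
Lemma Pol_T1_p_Delta (p : X * X -> X) : Pol (@T1 d X) (Op (p_Delta p)).
Proof.
move=> g Tg; have [F [k lt_F]] := Tg ord0.
have [B BP] := choice (fun u => image_below_bounded u (fun v => p (u, v))).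
have [B' B'P] := choice (fun a => image_below_bounded (F a) B).
exists B', k => x; rewrite /superpose /p_Delta.
have lt_B' := B'P (x k) _ (lt_F x).
case: ifP => [lt_g|_]; first exact: lt_trans (BP _ _ lt_g) lt_B'.
exact: le_lt_trans (le0x _) lt_B'.
Qed.

(** * Coordinates that bound an operation *)

Definition bounded_by {n} (f : op X n) (S : {set 'I_n}) :=
  forall a, exists b, forall x, (forall i, i \in S -> x i <= a) -> f x <= b.

Lemma bounded_byS {n} (f : op X n) (S S' : {set 'I_n}) :
  S \subset S' -> bounded_by f S -> bounded_by f S'.
Proof.
move=> sub bS a; have [b lt_b] := bS a; exists b => x le_x.
by apply: lt_b => i Si; apply: le_x; apply: (fintype.subsetP sub).
Qed.

(** If neither S nor its complement bounds f, there are points u(v) bounded on S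
and points w(v) bounded off S at which f exceeds v.  Walk along u on the axis
where the first variable is zero and along w on the other axis.  The coordinates
in S are then controlled by the first variable and the others by the second, so
all are almost unary, yet f is unbounded along both axes. *)
Lemma Pol_T1_bounded_by n (f : op X n.+1) (S : {set 'I_n.+1}) :
  Pol (@T1 d X) (Op f) -> bounded_by f S \/ bounded_by f (~: S)%SET.
Proof.
move=> Pf; apply: contrapT => /not_orP[nb nbC].
have unb (U : {set 'I_n.+1}) : ~ bounded_by f U -> exists a, forall b, exists x,
    (forall i, i \in U -> x i <= a) /\ b < f x.
  move=> nbU; apply: contrapT => bU; apply: nbU => a; apply: contrapT => nb'.
  apply: bU; exists a => b; apply: contrapT => nx; apply: nb'; exists b => x xU.
  by rewrite leNgt; apply/negP => lt_b; apply: nx; exists x.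
have {nb} [a0 /choice[u uP]] := unb _ nb.
have {nbC} [a1 /choice[w wP]] := unb _ nbC.
have [c lt_c] := exists_gt (\bot : X).
have succP (v : X) : exists y, v < y by apply: exists_gt.
have [s sP] := choice succP.
pose g i : op X 2 := fun x =>
  if x ord0 == \bot then u (x ord_max) i
  else if x ord_max == \bot then w (x ord0) i else \bot.
have Tg i : T1 (g i).
  rewrite /T1 /=; case: (boolP (i \in S)) => Si.
  - exists (fun v => s (Order.max a0 (w v i))), ord0 => x.
    apply: le_lt_trans (sP _); rewrite /g le_max.
    case: ifP => _; first by rewrite (uP _).1.
    by case: ifP => _; rewrite ?lexx ?orbT ?le0x.
  - exists (fun v => s (Order.max a1 (u v i))), ord_max => x.
    apply: le_lt_trans (sP _); rewrite /g le_max.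
    case: ifP => _; first by rewrite lexx orbT.
    by case: ifP => _; rewrite ?le0x // (wP _).1 // inE.
have [F [k lt_F]] := Pf g Tg.
pose pt a b : 'I_2 -> X := fun i => if i == ord0 then a else b.
case: (boolP (k == ord0)) => [/eqP k0|k1].
  have := lt_F (pt \bot (F \bot)); rewrite k0 /superpose /g /pt /= eqxx.
  by rewrite ltNge ltW // (uP _).2.
have k1E : k = ord_max by apply/val_inj; case: k k1 {lt_F} => [[|[|?]]].
(* The maximum with c keeps the first variable nonzero. *)
have := lt_F (pt (Order.max c (F \bot)) \bot).
rewrite k1E /superpose /g /pt /= eqxx gt_eqF; last by rewrite lt_max lt_c.
rewrite ltNge ltW // (le_lt_trans _ (wP _).2) //.
by rewrite le_max lexx orbT.
Qed.

(** * Operations in a clone above the generators *)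

Section Clone.
Context (p : X * X -> X).
Hypothesis pP : triangle_pairing p.
Context (C : set (operation X)).
Hypothesis cloneC : is_clone C.
Hypothesis C_unary : unary_ops `<=` C.
Hypothesis C_med3 : C (Op med3).
Hypothesis C_p : C (Op (p_Delta p)).

Lemma clone_comp_unary {n} (h : X -> X) (f : op X n.+1) :
  C (Op f) -> C (Op (fun x => h (f x))).
Proof.
move=> Cf; have Ch : C (Op (fun x : 'I_1 -> X => h (x ord0))).
  by apply: C_unary; exists (fun x => h (x ord0)).
exact: (cloneC.2 _ _ _ (fun=> f) Ch (fun=> Cf)).
Qed.

Lemma clone_comp_p_Delta {n} (f g : op X n.+1) : C (Op f) -> C (Op g) ->
  C (Op (fun x => if g x < f x then p (f x, g x) else \bot)).
Proof.
move=> Cf Cg.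
apply: (cloneC.2 _ _ _ (fun i : 'I_2 => if i == ord0 then f else g) C_p).
by move=> i; case: ifP.
Qed.

Lemma clone_comp_med3 {n} (t : 'I_3 -> op X n.+1) : (forall i, C (Op (t i))) ->
  C (Op (fun x => med3 (fun i => t i x))).
Proof. exact: (cloneC.2 _ _ _ t C_med3). Qed.

(** Two or fewer sets of the family have a common element, and a projection does.
Otherwise take three terms, each serving all the sets but one of the first
three; every set is served by at least two of the terms, so their median serves
it as well. *)
Lemma clone_above_intersecting {n} (r : seq {set 'I_n.+1}) :
  (forall V W, V \in r -> W \in r -> exists i, i \in V :&: W)%SET ->
  exists2 t : op X n.+1, C (Op t) &
    forall V x, V \in r -> exists2 i, i \in V & x i <= t x.
Proof.
have [m] := ubnP (size r); elim: m r => // m IHm r; rewrite ltnS => le_r rI.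
have common i : (forall V, V \in r -> i \in V) ->
    exists2 t : op X n.+1, C (Op t) &
    forall V x, V \in r -> exists2 i, i \in V & x i <= t x.
  move=> iV; exists (proj i); first exact: cloneC.1.
  by move=> V x /iV Vi; exists i.
case: r le_r rI common => [|V0 [|V1 [|V2 r]]] le_r rI common.
- exact: (common ord0).
- have [||i] := rI V0 V0; rewrite ?mem_head // finset.setIid => Vi.
  by apply: (common i) => V; rewrite inE => /eqP->.
- have [||i] := rI V0 V1; rewrite ?inE ?eqxx ?orbT // => /andP[V0i V1i].
  by apply: (common i) => V; rewrite !inE => /orP[]/eqP->.
have sub (q : seq {set 'I_n.+1}) : (size q < (size r).+3)%N ->
    {subset q <= [:: V0, V1, V2 & r]} -> exists2 t : op X n.+1, C (Op t) &
    forall V x, V \in q -> exists2 i, i \in V & x i <= t x.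
  move=> ltq subq; apply: IHm => [|V W qV qW]; first exact: leq_trans ltq le_r.
  by apply: rI; apply: subq.
have [||t0 Ct0 t0P] := sub [:: V1, V2 & r] => //.
  by move=> V; rewrite !inE => /or3P[]->; rewrite ?orbT.
have [||t1 Ct1 t1P] := sub [:: V0, V2 & r] => //.
  by move=> V; rewrite !inE => /or3P[]->; rewrite ?orbT.
have [||t2 Ct2 t2P] := sub [:: V0, V1 & r] => //.
  by move=> V; rewrite !inE => /or3P[]->; rewrite ?orbT.
pose t (i : 'I_3) := nth t0 [:: t0; t1; t2] i.
exists (fun x => med3 (fun i => t i x)).
  by apply: clone_comp_med3 => -[[|[|[|?]]]].
move=> V x rV.
have two (a b : 'I_3) : a != b -> (exists2 i, i \in V & x i <= t a x) ->
    (exists2 i, i \in V & x i <= t b x) ->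
    exists2 i, i \in V & x i <= med3 (fun i => t i x).
  move=> /(med3_sandwich (fun i => t i x))/andP[+ _] [i Vi le_i] [j Vj le_j].
  rewrite ge_min => /orP[le_t|le_t].
    by exists i => //; apply: le_trans le_t.
  by exists j => //; apply: le_trans le_t.
move: rV; rewrite !inE => /or4P[]V_.
- apply: (two (inord 1) (inord 2)); rewrite -?val_eqE /= ?/t ?inordK //=.
    by apply: t1P; rewrite !inE V_.
  by apply: t2P; rewrite !inE V_.
- apply: (two (inord 0) (inord 2)); rewrite -?val_eqE /= ?/t ?inordK //=.
    by apply: t0P; rewrite !inE V_.
  by apply: t2P; rewrite !inE V_ orbT.
- apply: (two (inord 0) (inord 1)); rewrite -?val_eqE /= ?/t ?inordK //=.
    by apply: t0P; rewrite !inE V_ orbT.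
  by apply: t1P; rewrite !inE V_ orbT.
- apply: (two (inord 0) (inord 1)); rewrite -?val_eqE /= ?/t ?inordK //=.
    by apply: t0P; rewrite !inE V_ !orbT.
  by apply: t1P; rewrite !inE V_ !orbT.
Qed.

(** The term t serves the sets whose complement does not bound f; then the set of
coordinates i with x_i <= t(x) does bound f, since otherwise its complement
would be one of those sets.  F is the largest of the bounds that belong to the
finitely many sets of coordinates. *)
Lemma Pol_T1_dominated n (f : op X n.+1) : Pol (@T1 d X) (Op f) ->
  exists (F : X -> X) (t : op X n.+1), C (Op t) /\ forall x, f x <= F (t x).
Proof.
move=> Pf.
pose r := [seq V <- enum {set 'I_n.+1} | `[< ~ bounded_by f (~: V)%SET >]].
have rE V : (V \in r) = `[< ~ bounded_by f (~: V)%SET >].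
  by rewrite mem_filter mem_enum andbT.
have [V W|t Ct tP] := clone_above_intersecting r.
  rewrite !rE => /asboolP nV /asboolP nW.
  apply: contrapT => dis.
  have [//|bV] := Pol_T1_bounded_by _ _ (~: V)%SET Pf.
  apply: nW; apply: bounded_byS bV; rewrite finset.setCK.
  apply/fintype.subsetP => i Vi; rewrite inE; apply/negP => Wi.
  by apply: dis; exists i; rewrite inE Vi.
have BP (S : {set 'I_n.+1}) : exists B : X -> X, bounded_by f S ->
    forall a x, (forall i, i \in S -> x i <= a) -> f x <= B a.
  have [/choice[B BP]|nS] := pselect (bounded_by f S); first by exists B.
  by exists id.
have [B {}BP] := choice BP.
exists (fun a => \big[Order.max/(\bot : X)]_(S : {set 'I_n.+1}) B S a), t.
split=> // x.
pose S : {set 'I_n.+1} := finset (fun i => x i <= t x).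
apply: le_trans (le_bigmax _ (fun S => B S (t x)) S).
apply: BP => [|i]; last by rewrite inE.
apply: contrapT => nS; have [|i] := tP (~: S)%SET x.
  by rewrite rE finset.setCK; apply/asboolP.
by rewrite !inE => /negP nle /nle.
Qed.

(** Take s(c) := p(u, c) for a suitable u > c: as u varies, these values are
distinct and therefore unbounded. *)
Lemma exists_growing_injection (m : X -> X) :
  exists2 s : X -> X, injective s & forall c, m c < s c.
Proof.
have [p_inj _] := pP.
have sP c : exists u, c < u /\ m c < p (u, c).
  have [phi phi_inj gt_phi] := injection_above c.
  have pphi_inj : injective (fun v => p (phi v, c)).
    by move=> v v' /p_inj[]// /phi_inj.
  have [b lt_b] := exists_gt (m c).
  have [v le_b] := injection_unbounded pphi_inj b.
  by exists (phi v); split=> //; apply: lt_le_trans le_b.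
have [u uP] := choice sP.
exists (fun c => p (u c, c)) => [c c' /p_inj[]|c]; try by case: (uP c).
by case: (uP c').
Qed.

(** A value f(x) that is a function of a list g_i(x) with g_i <= z, or is zero
where some g_i exceeds z, is computed in the clone from z and the g_i.  Start
with c := z(x) and replace c by [push c (g_i x)] for each i in turn.  The unary
injection s makes room at each step: it exceeds c, so that g_i(x) < s(c) and the
pairing is in its injective range, and it exceeds the first component of a
pair c, so that s(c) grows along the list.  Hence at a point where all g_i <= z
the final code determines z and all g_i, and every point with the same code has
the same values. *)
Lemma clone_factor {n m} (f z : op X n.+1) (g : 'I_m -> op X n.+1) :
  C (Op z) -> (forall i, C (Op (g i))) ->
  (forall x y, (forall i, g i x <= z x) -> z x = z y ->
     (forall i, g i x = g i y) -> f x = f y) ->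
  (forall x i, z x < g i x -> f x = \bot) ->
  C (Op f).
Proof.
move=> Cz Cg f_det f_bot; have [p_inj p_neq0] := pP.
(* mu c bounds both c and the first component of the pair coded by c, if any. *)
have muP c : exists a, c <= a /\ forall u v, v < u -> p (u, v) = c -> u <= a.
  have [[u [v [lt_vu pc]]]|no] := pselect (exists u v, v < u /\ p (u, v) = c).
    exists (Order.max c u); split=> [|u' v' lt_vu']; first by rewrite le_max lexx.
    by rewrite -pc => /p_inj[]// -> _; rewrite le_max lexx orbT.
  by exists c; split=> // u v lt_vu pc; case: no; exists u, v.
have [mu {}muP] := choice muP.
have [s s_inj lt_mu] := exists_growing_injection mu.
have lt_s c : c < s c := le_lt_trans (muP c).1 (lt_mu c).
pose push c y := if y < s c then p (s c, y) else \bot.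
have push_grow c y : y < s c -> s c < s (push c y).
  move=> lt_y; rewrite /push lt_y.
  by apply: le_lt_trans (lt_mu _); apply: (muP _).2 lt_y _.
(* Room is required on one side only: zero is no pair. *)
have push_inj c y c' y' : y < s c -> push c y = push c' y' -> c = c' /\ y = y'.
  rewrite /push => lt_y; rewrite lt_y; case: ifP => [lt_y'|_].
    by move=> /p_inj[]// /s_inj.
  by move=> /p_neq0-/(_ lt_y).
pose code (x : 'I_n.+1 -> X) l c := foldl (fun c i => push c (g i x)) c l.
have code_inj x y l c c' : (forall i, i \in l -> g i x < s c) ->
    code x l c = code y l c' -> c = c' /\ forall i, i \in l -> g i x = g i y.
  elim: l c c' => [|i l IHl] c c' lt_g //=.
  have lt_i : g i x < s c by apply: lt_g; rewrite mem_head.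
  move=> /IHl[j lj|/push_inj[]// eq_c eq_gi eq_g].
    by apply: lt_trans (push_grow _ _ lt_i); apply: lt_g; rewrite inE lj orbT.
  by split=> // j; rewrite inE => /predU1P[->|/eq_g].
have Ccode l : C (Op (fun x => code x l (z x))).
  move: z Cz {f_det f_bot}; elim: l => // i l IHl c Cc.
  apply: (IHl (fun x => push (c x) (g i x))).
  by apply: clone_comp_p_Delta => //; apply: clone_comp_unary.
pose P x := forall i, g i x <= z x.
pose E x := code x (enum 'I_m) (z x).
have E_det x y : P x -> E x = E y -> f x = f y.
  move=> Px /code_inj[i _|eq_z eq_g].
    exact: le_lt_trans (Px i) (lt_s _).
  by apply: f_det => // i; apply: eq_g; rewrite mem_enum.
(* A code met by no point of P decodes to zero. *)
have hP e : exists v, forall x, E x = e -> f x = v.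
  have [[y [Py Ey]]|no] := pselect (exists y, P y /\ E y = e).
    by exists (f y) => x Ex; symmetry; apply: E_det => //; rewrite Ey.
  exists \bot => x Ex.
  have [i lt_i] : exists i, z x < g i x.
    apply: contrapT => nlt; apply: no; exists x; split=> // i.
    by rewrite leNgt; apply/negP => lt_i; apply: nlt; exists i.
  exact: f_bot lt_i.
have [h {}hP] := choice hP.
rewrite (_ : f = fun x => h (E x)); last by apply/funext => x; apply: hP.
exact: clone_comp_unary (Ccode _).
Qed.

(** * Generation *)

Lemma Pol_T1_sub_clone : Pol (@T1 d X) `<=` C.
Proof.
move=> [n f] /Pol_T1_dominated[F [t [Ct le_f]]].
pose f_ (j : 'I_n.+1) : op X n.+1 :=
  fun x => if [forall i, x i <= x j] then f x else \bot.
have f_le j x : f_ j x <= f x by rewrite /f_; case: ifP.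
have Cf_ j : C (Op (f_ j)).
  apply: (@clone_factor _ _ (f_ j) (proj j) (@proj X n.+1)).
  - exact: cloneC.1.
  - exact: cloneC.1.
  - by move=> x y _ _ eq_xy; congr f_; apply/funext.
  move=> x i; rewrite /proj /f_ ltNge => /negP nle.
  by case: forallP => // /(_ i).
have f_max x : exists j, f_ j x = f x.
  have [j _ maxj] :=
    Order.TotalTheory.arg_maxP x (erefl : xpredT (ord0 : 'I_n.+1)).
  exists j; rewrite /f_; case: forallP => // -[] i; exact: maxj.
apply: (@clone_factor _ _ f (fun x => F (t x)) f_) => //.
- exact: clone_comp_unary.
- move=> x y _ _ eq_f; apply/le_anti/andP; split.
    by have [j <-] := f_max x; rewrite eq_f f_le.
  by have [j <-] := f_max y; rewrite -eq_f f_le.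
by move=> x i; rewrite ltNge (le_trans (f_le _ _) (le_f _)).
Qed.

End Clone.

Lemma Pol_T1_generated (p : X * X -> X) : triangle_pairing p ->
  Pol (@T1 d X) = clone_gen ([set Op med3; Op (p_Delta p)] `|` unary_ops).
Proof.
move=> pP; apply/seteqP; split=> [f Pf C [cloneC genC]|].
  apply: (Pol_T1_sub_clone p) Pf => //.
  - by move=> g Ug; apply: genC; right.
  - by apply: genC; left; left.
  - by apply: genC; left; right.
apply: smallest_sub; first exact: Pol_T1_clone.
move=> f [[->|->]|].
- exact: Pol_T1_med3.
- exact: Pol_T1_p_Delta.
- exact: Pol_T1_unary.
Qed.

End RegularCardinals.

Theorem corollary49 (d : Order.disp_t) (X : bOrderType d) :
  infinite_regular_cardinal X ->
  (forall p : X * X -> X, injective p -> (forall u, p u <> (\bot)%O) ->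
     Pol (@T1 d X) = clone_gen ([set Op med3; Op (p_Delta p)] `|` unary_ops)) /\
  (exists F : set (operation X), finite_set F /\
     Pol (@T1 d X) = clone_gen (F `|` unary_ops)).
Proof.
move=> regX; split=> [p p_inj p_neq0|].
  apply: Pol_T1_generated => //; split=> [u v u' v' _ _ /p_inj[-> ->]|u v _] //.
have [p pP] := exists_triangle_pairing _ _ regX.
exists [set Op med3; Op (p_Delta p)]; split; first by apply: finite_set2.
exact: Pol_T1_generated.
Qed.
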